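(* Let $G$ be a non-terminal position, given as the root of a finite game tree. Assume that, in the game tree of $G$, every edge leading to a terminal position is special and that no other edge is special. When Rules 2 and 3 (defined in the context) are played on $G$ under normal play, from their respective starting states (no token in the one-pile Nim component for Rule 2, one token for Rule 3), their SG values coincide, respectively, with the SG values of the original game (without the one-pile Nim component) under misère play and under play with a pass; that is, $$\mathcal{G}_2(G,0)=\mathcal{G}^-(G)\qquad\text{and}\qquad \mathcal{G}_3(G,1)=\mathcal{G}((G,1)).$$
   Context: All games are impartial and short. A game is given by its game tree, a finite rooted tree: positions are vertices, the options of a position $G$ are its children (write $G\to G'$ if $G'$ is an option of $G$), and terminal positions are leaves. For a finite set $S$ of nonnegative integers, $\mathrm{mex}(S)$ is the least nonnegative integer not in $S$. Normal-play SG value: $\mathcal{G}(G)=\mathrm{mex}(\{\mathcal{G}(G')\mid G\to G'\})$. Misère SG value: $\mathcal{G}^-(G)=1$ if $G$ is terminal, and $\mathcal{G}^-(G)=\mathrm{mex}(\{\mathcal{G}^-(G')\mid G\to G'\})$ otherwise. Play with a (single shared) pass: at most one pass may be used in total during the game, by either player, and passing is not allowed at a terminal position. $(G,1)$ denotes the position $G$ with the pass still available (and $(G,0)$, after the pass has been used, is the same as $G$). Its SG value is $\mathcal{G}((G,1))=0$ if $G$ is terminal, and $\mathcal{G}((G,1))=\mathrm{mex}(\{\mathcal{G}(G)\}\cup\{\mathcal{G}((G',1))\mid G\to G'\})$ otherwise. Rules 2 and 3: the edges of the game tree are partitioned into ordinary edges and special edges so that every root-to-leaf path contains at most one special edge.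 A position of the combined game is a pair $(G,p)$, where $G$ is a vertex of the tree and $p\in\{0,1\}$ is the number of tokens in a one-pile Nim component. For a vertex $G$ let $S_1(G)$ be the set of its children reached by ordinary edges, and $S_2(G)$ the set of its children reached by special edges. The legal moves from $(G,p)$ are as follows. Rule 2 (the game starts with $p=0$): move to $(G',p)$ for any $G'\in S_1(G)$; move to $(G',p+1)$ for any $G'\in S_2(G)$ (moving along a special edge adds one token); and, if $p=1$, move to $(G,0)$. Since play starts with no token and each path has at most one special edge, the number of tokens never exceeds $1$. Rule 3 (the game starts with $p=1$): move to $(G',p)$ for any $G'\in S_1(G)$; move to $(G',0)$ for any $G'\in S_2(G)$ (moving along a special edge also removes the token, if present); and, if $p=1$, move to $(G,0)$. For $i=2,3$, $\mathcal{G}_i(G,p)$ is the normal-play SG value of $(G,p)$ under Rule $i$, i.e. the mex of the values $\mathcal{G}_i$ of all positions reachable from $(G,p)$ in one legal move under Rule $i$. *)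

(* Defs.v *)
From Stdlib Require List.
From mathcomp Require Import all_boot.

Set Implicit Arguments.
Unset Strict Implicit.
Unset Printing Implicit Defensive.

Lemma mex_exists (s : seq nat) : exists n, n \notin s.
Proof.
exists (\max_(i <- s) i).+1; apply/negP => ins.
by have := @leq_bigmax_seq _ s xpredT id _ ins isT; rewrite ltnn.
Qed.

Definition mex (s : seq nat) : nat := ex_minn (mex_exists s).

(* A vertex is identified with the subtree below it.  Each edge to a child
   carries a boolean, [true] for special edges and [false] for ordinary ones. *)
Inductive gtree : Type := Node of seq (bool * gtree).

Definition edges (G : gtree) : seq (bool * gtree) := let: Node es := G in es.

Definition special (e : bool * gtree) : bool := e.1.
Definition target (e : bool * gtree) : gtree := e.2.

Definition terminal (G : gtree) : bool := nilp (edges G).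

Definition S1 (G : gtree) : seq gtree :=
  [seq target e | e <- edges G & ~~ special e].
Definition S2 (G : gtree) : seq gtree :=
  [seq target e | e <- edges G & special e].

(* [P] holds for every edge of the whole tree, not only for those at the root. *)
Fixpoint all_edges (P : pred (bool * gtree)) (G : gtree) : bool :=
  let: Node es := G in all (fun e => P e && all_edges P e.2) es.

(* The largest number of special edges on a root-to-leaf path. *)
Fixpoint max_special (G : gtree) : nat :=
  let: Node es := G in
  foldr maxn 0 [seq special e + max_special e.2 | e <- es].

(* The values of the original game ignore the edge labels. *)
Fixpoint sg_normal (G : gtree) : nat :=
  let: Node es := G in mex [seq sg_normal e.2 | e <- es].

Fixpoint sg_misere (G : gtree) : nat :=
  let: Node es := G in
  if terminal G then 1 else mex [seq sg_misere e.2 | e <- es].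

(* The value of (G,1), the pass being still available. *)
Fixpoint sg_pass (G : gtree) : nat :=
  let: Node es := G in
  if terminal G then 0 else mex (sg_normal G :: [seq sg_pass e.2 | e <- es]).

(* [map] for a function defined only on the members of the list. *)
Fixpoint map_In (T U : Type) (s : seq T) :
    (forall x, List.In x s -> U) -> seq U :=
  match s with
  | [::] => fun _ => [::]
  | x :: s' => fun f =>
      f x (or_introl erefl) :: map_In (fun y ys' => f y (or_intror ys'))
  end.

Lemma map_InE (T U : Type) (f : T -> U) (s : seq T) :
  map_In (fun x (_ : List.In x s) => f x) = map f s.
Proof. by elim: s => //= x s ->. Qed.

Lemma eq_map_In (T U : Type) (s : seq T) (f g : forall x, List.In x s -> U) :
  (forall x xs, f x xs = g x xs) -> map_In f = map_In g.
Proof.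
elim: s f g => //= x s IHs f g fg; rewrite fg; congr (_ :: _).
by apply: IHs => y ys; apply: fg.
Qed.

Definition is_move (T : Type) (moves : T -> seq T) (y x : T) : Prop :=
  List.In y (moves x).

(* The normal-play SG value for an arbitrary terminating move function; its
   defining equation is [sgE]. *)
Definition sg (T : Type) (moves : T -> seq T)
    (wf : well_founded (is_move moves)) : T -> nat :=
  Fix wf (fun _ => nat) (fun x rec => mex (map_In rec)).

Lemma sgE (T : Type) (moves : T -> seq T) (wf : well_founded (is_move moves)) x :
  sg wf x = mex [seq sg wf y | y <- moves x].
Proof.
rewrite {1}/sg Fix_eq => [|y f g fg]; last by congr mex; apply: eq_map_In.
by rewrite -map_InE.
Qed.

(* The number of tokens is a natural number; from its starting state each rule
   only reaches 0 and 1 as long as [max_special G <= 1]. *)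
Definition position : Type := gtree * nat.

Definition moves2 (x : position) : seq position :=
  let: (G, p) := x in
  [seq (G', p) | G' <- S1 G] ++ [seq (G', p.+1) | G' <- S2 G]
  ++ (if p == 1 then [:: (G, 0)] else [::]).

Definition moves3 (x : position) : seq position :=
  let: (G, p) := x in
  [seq (G', p) | G' <- S1 G] ++ [seq (G', 0) | G' <- S2 G]
  ++ (if p == 1 then [:: (G, 0)] else [::]).

Lemma gtree_all_ind (P : gtree -> Prop) :
  (forall es, (forall e, List.In e es -> P (target e)) -> P (Node es)) ->
  forall G, P G.
Proof.
move=> IH; fix gind 1 => -[es]; apply: IH.
elim: es => [|[b G] es IHes] e /=; first by case.
by case=> [<-|ine]; [exact: (gind G) | exact: IHes].
Qed.

Lemma S1_edge G G' : List.In G' (S1 G) -> exists b, List.In (b, G') (edges G).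
Proof.
by move=> /List.in_map_iff[[b H] [/= <-]] /List.filter_In[inE _]; exists b.
Qed.

Lemma S2_edge G G' : List.In G' (S2 G) -> exists b, List.In (b, G') (edges G).
Proof.
by move=> /List.in_map_iff[[b H] [/= <-]] /List.filter_In[inE _]; exists b.
Qed.

Lemma position_wf (moves : position -> seq position) :
  (forall G p x, List.In x (moves (G, p)) ->
     (exists b, List.In (b, x.1) (edges G)) \/ p = 1 /\ x = (G, 0)) ->
  well_founded (is_move moves).
Proof.
move=> movesP [G p]; elim/gtree_all_ind: G p => es IH.
have acc0 : Acc (is_move moves) (Node es, 0).
  split=> -[H q] /movesP[[b /IH/(_ q)]//|[]//].
by move=> p; split=> -[H q] /movesP[[b /IH/(_ q)]//|[_ ->]].
Qed.

Lemma moves2_wf : well_founded (is_move moves2).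
Proof.
apply: position_wf => G p x /List.in_app_iff[|/List.in_app_iff[]].
- by move=> /List.in_map_iff[H [<- /S1_edge]]; left.
- by move=> /List.in_map_iff[H [<- /S2_edge]]; left.
- by case: eqP => // -> [<-|//]; right.
Qed.

Lemma moves3_wf : well_founded (is_move moves3).
Proof.
apply: position_wf => G p x /List.in_app_iff[|/List.in_app_iff[]].
- by move=> /List.in_map_iff[H [<- /S1_edge]]; left.
- by move=> /List.in_map_iff[H [<- /S2_edge]]; left.
- by case: eqP => // -> [<-|//]; right.
Qed.

Definition sg2 (G : gtree) (p : nat) : nat := sg moves2_wf (G, p).
Definition sg3 (G : gtree) (p : nat) : nat := sg moves3_wf (G, p).

Definition special_iff_terminal (G : gtree) : bool :=
  all_edges (fun e => special e == terminal (target e)) G.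

(* Such a labelling is one to which Rules 2 and 3 apply. *)
Lemma special_iff_terminal_max_special G :
  special_iff_terminal G -> max_special G <= 1.
Proof.
rewrite /special_iff_terminal; elim/gtree_all_ind: G => es /=.
elim: es => //= -[b H] es IHes IH /andP[/andP[/eqP bE okH] okes].
rewrite geq_max IHes ?andbT//; last by move=> e ine; apply: IH; right.
move: bE; rewrite /special /target /= => ->.
have := IH _ (or_introl erefl) okH; rewrite /target /=.
by case: H {IH okH} => -[|e fs].
Qed.

(* Main.v *)
Require Import Defs.
From mathcomp Require Import all_boot.

(** Under this labelling the special move is the one that ends the original
    game.  So, until the token is removed separately, its presence tells
    whether the original game is over: under Rule 2 the token is created by the
    last move of the original game, under Rule 3 it is destroyed by it.  It is
    therefore enough to evaluate Rule 2 at the positions [(G, terminal G)] and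
    Rule 3 at the positions [(G, ~~ terminal G)]; there the claim also holds
    for terminal [G], and structural induction applies ([sg2_terminal] and
    [sg3_nonterminal]).

    Under Rule 2 a terminal [G] carries one token, hence has value
    [mex {0} = 1], the misère value; at a nonterminal [G] there is no token to
    remove and the moves are those of the original game.  Under Rule 3 a
    terminal [G] has no token and has value 0, as with a pass; at a
    nonterminal [G] the only move besides those of the original game removes
    the token.  Without a token, Rule 3 no longer distinguishes the edges, so
    this move leads to the normal-play value of [G] ([sg3_no_token]), just as
    using the pass does. *)

Lemma eq_mex (s t : seq nat) : s =i t -> mex s = mex t.
Proof.
move=> st; rewrite /mex; case: ex_minnP => m ms minm.
case: ex_minnP => n nt minn; apply/eqP; rewrite eqn_leq.
by rewrite minm ?st // minn -?st.
Qed.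

Lemma mex_nil : mex [::] = 0.
Proof. by rewrite /mex; case: ex_minnP => m _ /(_ 0 isT); case: m. Qed.

Lemma mex_seq1_0 : mex [:: 0] = 1.
Proof.
by rewrite /mex; case: ex_minnP => m + /(_ 1 isT); case: m => [|[|m]].
Qed.

(** Listing the moves edge by edge instead of by kind of edge makes them
    comparable with the recursion of the original game; [xs] stands for the
    removal of the token. *)
Lemma mex_S1_S2 (T : Type) (v : T -> nat) (f g : gtree -> T) xs (G : gtree) :
  mex [seq v x | x <- [seq f H | H <- S1 G] ++ [seq g H | H <- S2 G] ++ xs] =
  mex ([seq v x | x <- xs] ++
       [seq v ((if special e then g else f) (target e)) | e <- edges G]).
Proof.
apply: eq_mex => n; rewrite !map_cat !mem_cat orbA orbC; congr (_ || _).
rewrite /S1 /S2; elim: (edges G) => //= e es IHes.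
case: (special e) => /=; rewrite !inE -IHes; first by rewrite orbCA.
by rewrite orbA.
Qed.

Lemma sg2E (G : gtree) (p : nat) :
  sg2 G p = mex ((if p == 1 then [:: sg2 G 0] else [::]) ++
                 [seq sg2 (target e) (p + special e) | e <- edges G]).
Proof.
rewrite {1}/sg2 sgE mex_S1_S2; congr (mex (_ ++ _)); first by case: (p == 1).
by apply: eq_map => e; case: (special e); rewrite ?addn1 ?addn0.
Qed.

Lemma sg3E (G : gtree) (p : nat) :
  sg3 G p = mex ((if p == 1 then [:: sg3 G 0] else [::]) ++
                 [seq sg3 (target e) (if special e then 0 else p)
                 | e <- edges G]).
Proof.
rewrite {1}/sg3 sgE mex_S1_S2; congr (mex (_ ++ _)); first by case: (p == 1).
by apply: eq_map => e; case: (special e).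
Qed.

Lemma eq_map_ListIn (T U : Type) (f g : T -> U) (es : seq T) :
  (forall e, List.In e es -> f e = g e) -> map f es = map g es.
Proof.
elim: es => //= e es IHes fg; congr (_ :: _); first by apply: fg; left.
by apply: IHes => d d_es; apply: fg; right.
Qed.

Lemma special_iff_terminal_edge (G : gtree) (e : bool * gtree) :
  special_iff_terminal G -> List.In e (edges G) ->
  special e = terminal (target e) /\ special_iff_terminal (target e).
Proof.
case: G => es; rewrite /special_iff_terminal /=.
elim: es => //= d es IHes /andP[/andP[/eqP spd okd] okes] [<-|] //.
exact: IHes.
Qed.

(** With no token to remove, a special edge acts as an ordinary one. *)
Lemma sg3_no_token (G : gtree) : sg3 G 0 = sg_normal G.
Proof.
elim/gtree_all_ind: G => es IH; rewrite sg3E /=.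
congr mex; apply: eq_map_ListIn => e /IH <-.
by case: (special e).
Qed.

(** The number of tokens is tied to [terminal G] so that the induction
    hypothesis also covers the children that are terminal: the edge to such a
    child is special and creates the token counted there. *)
Lemma sg2_terminal (G : gtree) :
  special_iff_terminal G -> sg2 G (terminal G) = sg_misere G.
Proof.
elim/gtree_all_ind: G => es IH okG; rewrite sg2E.
case: es => [|e0 es] in IH okG *; first by rewrite sg2E /= mex_nil mex_seq1_0.
congr mex; apply: eq_map_ListIn => e ine.
have [-> oke] := special_iff_terminal_edge _ _ okG ine.
exact: IH.
Qed.

(** Here the token stands for the pass: it is lost on reaching a terminal
    child, where passing is forbidden, and removing it earlier is passing. *)
Lemma sg3_nonterminal (G : gtree) :
  special_iff_terminal G -> sg3 G (~~ terminal G) = sg_pass G.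
Proof.
elim/gtree_all_ind: G => es IH okG; rewrite sg3E.
case: es => [|e0 es] in IH okG *; first by rewrite /= mex_nil.
rewrite sg3_no_token; congr (mex (_ :: _)); apply: eq_map_ListIn => e ine.
have [-> oke] := special_iff_terminal_edge _ _ okG ine.
by rewrite -[RHS](IH _ ine oke); case: (terminal _).
Qed.

Theorem lemma1 (G : gtree) (G_nonterminal : ~~ terminal G)
    (G_special : special_iff_terminal G) :
  sg2 G 0 = sg_misere G /\ sg3 G 1 = sg_pass G.
Proof.
split.
- by rewrite -sg2_terminal // (negbTE G_nonterminal).
- by rewrite -sg3_nonterminal // G_nonterminal.
Qed.
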